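(* Let $B\in\mathbb{C}^{m\times n}$, $\tilde W\in\mathbb{C}^{n\times m}$, $\tilde k=\mathrm{ind}(B\tilde W)$, and let $X\in\mathbb{C}^{m\times n}$ be a minimal rank $W$-weighted weak Drazin inverse of $B$. For $Y\in\mathbb{C}^{n\times m}$ the following are equivalent: (i) $Y=B^{\dagger}B\tilde W X\tilde W$, i.e. $Y$ is the $W$-weighted weak MPD inverse of $B$ (associated with $X$); (ii) $YBY=Y$, $BYB=B\tilde W X\tilde W B$, $BY=B\tilde W X\tilde W$ and $Y(B\tilde W)^{\tilde k+1}=B^{\dagger}(B\tilde W)^{\tilde k+1}$; (iii) $YBY=Y$, $BY=B\tilde W X\tilde W$ and $YB=B^{\dagger}BYB$; (iv) $BY=B\tilde W X\tilde W$, $YB=B^{\dagger}BYB$ and $Y=B^{\dagger}BY$; (v) $YBY=Y$, $BY=B\tilde W X\tilde W$, $Y(B\tilde W)^{\tilde k+1}=B^{\dagger}(B\tilde W)^{\tilde k+1}$ and $YX=B^{\dagger}X$; (vi) $Y=B^{\dagger}BY$, $BY=B\tilde W X\tilde W$ and $YXB^{\dagger}=B^{\dagger}XB^{\dagger}$; (vii) $Y=B^{\dagger}BY$, $BY=B\tilde W X\tilde W$ and $YX\tilde W B=B^{\dagger}X\tilde W B$.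
   Context: For a square complex matrix $T$, $\mathrm{ind}(T)$ is the smallest nonnegative integer $k$ with $\mathrm{rank}(T^k)=\mathrm{rank}(T^{k+1})$ (with $T^0=I$). $B^{\dagger}$ is the Moore-Penrose inverse. For $B\in\mathbb{C}^{m\times n}$, $\tilde W\in\mathbb{C}^{n\times m}$ and $\tilde k=\mathrm{ind}(B\tilde W)$, a matrix $X\in\mathbb{C}^{m\times n}$ is a minimal rank $W$-weighted weak Drazin inverse of $B$ (with respect to the weight $\tilde W$) if $X\tilde W(B\tilde W)^{\tilde k+1}=(B\tilde W)^{\tilde k}$ and $\mathrm{rank}(X)=\mathrm{rank}((B\tilde W)^{\tilde k})$. For a fixed such $X$, the $W$-weighted weak MPD inverse of $B$ is $B^{\dagger}B\tilde W X\tilde W$. *)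

(* Defs.v *)
From HB Require Import structures.
From mathcomp Require Import all_boot all_order all_algebra.

Set Implicit Arguments.
Unset Strict Implicit.
Unset Printing Implicit Defensive.

Import Order.TTheory GRing.Theory Num.Theory.

Local Open Scope ring_scope.
Local Open Scope sesquilinear_scope.

Section MatrixIndex.

Variables (F : fieldType) (m : nat).
Implicit Type T : 'M[F]_m.

Lemma mxindex_ex T : exists k, \rank (T ^+ k) == \rank (T ^+ k.+1).
Proof.
suff H r k : (\rank (T ^+ k) <= r)%N ->
    exists j, \rank (T ^+ j) == \rank (T ^+ j.+1).
  exact: (H _ 0 (leqnn _)).
elim: r k => [|r IHr] k le_r.
  have le_S : (\rank (T ^+ k.+1) <= \rank (T ^+ k))%N.
    by rewrite exprS; apply: mxrankM_maxr.
  exists k; move: le_S; move: le_r; rewrite leqn0 => /eqP->.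
  by rewrite leqn0 eq_sym.
have le_S : (\rank (T ^+ k.+1) <= \rank (T ^+ k))%N.
  by rewrite exprS; apply: mxrankM_maxr.
case: (eqVneq (\rank (T ^+ k)) (\rank (T ^+ k.+1))) => [/eqP|neq].
  by exists k.
apply: (IHr k.+1); rewrite -ltnS; apply: leq_trans le_r.
by rewrite ltn_neqAle eq_sym neq.
Qed.

Definition mxindex T : nat := ex_minn (mxindex_ex T).

Lemma mxindexP T :
  \rank (T ^+ mxindex T) = \rank (T ^+ (mxindex T).+1) /\
  forall k, \rank (T ^+ k) = \rank (T ^+ k.+1) -> (mxindex T <= k)%N.
Proof.
rewrite /mxindex; case: ex_minnP => k /eqP rk min_k.
by split=> // j rj; apply: min_k; apply/eqP.
Qed.

End MatrixIndex.

Section MoorePenrose.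

Variable C : numClosedFieldType.

Definition penrose m n (B : 'M[C]_(m, n)) (X : 'M[C]_(n, m)) : bool :=
  [&& B *m X *m B == B,
      X *m B *m X == X,
      (B *m X)^t* == B *m X &
      (X *m B)^t* == X *m B].

Lemma trmxC_mul m n p (A : 'M[C]_(m, n)) (B : 'M[C]_(n, p)) :
  (A *m B)^t* = B^t* *m A^t*.
Proof. by rewrite trmx_mul map_mxM. Qed.

Lemma gram_unit m n (A : 'M[C]_(m, n)) :
  row_free A -> A *m A^t* \in unitmx.
Proof.
move=> freeA; rewrite -row_free_unit; apply: inj_row_free => v vA0.
apply: (row_free_inj freeA); rewrite mul0mx; apply/eqP.
rewrite -(dnorm_eq0 (@dotmx C n)); apply/eqP.
apply: etrans (dotmxE _ _) _; rewrite trmxC_mul !mulmxA.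
by rewrite -(mulmxA v) vA0 mul0mx mxE.
Qed.

(* (L R)^+ = R^* (R R^* )^-1 (L^* L)^-1 L^* for a full rank factorization L R *)
Lemma penrose_full_rank m r n (L : 'M[C]_(m, r)) (R : 'M[C]_(r, n)) :
  row_full L -> row_free R ->
  penrose (L *m R)
    (R^t* *m invmx (R *m R^t*) *m (invmx (L^t* *m L) *m L^t*)).
Proof.
move=> fullL freeR; have uR := gram_unit freeR.
have uL : L^t* *m L \in unitmx.
  rewrite -{2}[L]trmxCK; apply: gram_unit.
  by rewrite /row_free mxrank_map mxrank_tr.
have RR' : R *m (R^t* *m invmx (R *m R^t*)) = 1%:M.
  by rewrite mulmxA mulmxV.
have L'L : invmx (L^t* *m L) *m L^t* *m L = 1%:M by rewrite -mulmxA mulVmx.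
have herm_inv p (G : 'M[C]_p) : G^t* = G -> (invmx G)^t* = invmx G.
  by move=> GE; rewrite trmx_inv map_invmx GE.
have hR : (R *m R^t*)^t* = R *m R^t* by rewrite trmxC_mul trmxCK.
have hL : (L^t* *m L)^t* = L^t* *m L by rewrite trmxC_mul trmxCK.
set R' := _ *m invmx (R *m _) in RR' *; set L' := _ *m L^t* in L'L *.
have BX : L *m R *m (R' *m L') = L *m L'.
  by rewrite mulmxA -(mulmxA L) RR' mulmx1.
have XB : R' *m L' *m (L *m R) = R' *m R.
  by rewrite mulmxA -(mulmxA R') L'L mulmx1.
apply/and4P; split; apply/eqP.
- by rewrite BX mulmxA -(mulmxA L) L'L mulmx1.
- by rewrite XB mulmxA -(mulmxA R') RR' mulmx1.
- by rewrite BX !trmxC_mul herm_inv // trmxCK mulmxA.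
- by rewrite XB !trmxC_mul herm_inv // trmxCK mulmxA.
Qed.

Lemma penrose_ex m n (B : 'M[C]_(m, n)) : exists X, penrose B X.
Proof.
have := penrose_full_rank (col_base_full B) (row_base_free B).
by rewrite mulmx_base => BX; eexists; apply: BX.
Qed.

Lemma penrose_uniq m n (B : 'M[C]_(m, n)) X Y :
  penrose B X -> penrose B Y -> X = Y.
Proof.
case/and4P=> /eqP BXB /eqP XBX /eqP hBX /eqP hXB.
case/and4P=> /eqP BYB /eqP YBY /eqP hBY /eqP hYB.
have eBX : B *m X = B *m Y.
  rewrite -hBX -{1}BYB -[_ *m B *m X]mulmxA trmxC_mul hBX hBY.
  by rewrite mulmxA BXB.
have eXB : X *m B = Y *m B.
  rewrite -hXB -{1}BYB -[B *m Y *m B]mulmxA mulmxA trmxC_mul hXB hYB.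
  by rewrite -mulmxA [B *m _]mulmxA BXB.
by rewrite -XBX eXB -mulmxA eBX mulmxA YBY.
Qed.

Definition mpinv m n (B : 'M[C]_(m, n)) : 'M[C]_(n, m) :=
  xchoose (penrose_ex B).

Lemma mpinvP m n (B : 'M[C]_(m, n)) : penrose B (mpinv B).
Proof. exact: xchooseP. Qed.

End MoorePenrose.

Section Weighted.

Variables (C : numClosedFieldType) (m n : nat).
Implicit Types (B X : 'M[C]_(m, n)) (W : 'M[C]_(n, m)).

Definition minrank_weighted_weak_Drazin B W X : Prop :=
  let k := mxindex (B *m W) in
  X *m W *m (B *m W) ^+ k.+1 = (B *m W) ^+ k /\
  \rank X = \rank ((B *m W) ^+ k).

Definition weighted_weak_MPD B W X : 'M[C]_(n, m) :=
  mpinv B *m B *m W *m X *m W.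

End Weighted.

(* Main.v *)
(* With A = B W and k = ind A, equality of ranks gives range X = range A^k, so
   X = A^k Z; hence P = A X W is idempotent with P X = X and P A^(k+1) = A^(k+1).
   Each of the conditions then amounts to Y = B^+ P. *)
Require Import Defs.
From mathcomp Require Import all_boot all_order all_algebra.
From mathcomp Require Import reals complex.

Set Implicit Arguments.
Unset Strict Implicit.
Unset Printing Implicit Defensive.

Import Order.TTheory GRing.Theory Num.Theory.

Local Open Scope ring_scope.

(** The column space of [M] lies in that of [N], so equal ranks make the two coincide. Transposes
    are taken because [<=] on matrices compares row spaces. *)
Lemma mul_mxrank_eq_exr (F : fieldType) m n p (M : 'M[F]_(m, n))
    (N : 'M[F]_(m, p)) (K : 'M[F]_(p, n)) :
  M = N *m K -> \rank M = \rank N -> exists V, N = M *m V.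
Proof.
move=> MNK rkMN.
have leMN : (M^T <= N^T)%MS by rewrite MNK trmx_mul submxMl.
have /submxP[V NV] : (N^T <= M^T)%MS.
  by rewrite -(mxrank_leqif_sup leMN) !mxrank_tr rkMN.
by exists V^T; rewrite -[N]trmxK NV trmx_mul trmxK.
Qed.

Lemma mxindex_exprS_exr (F : fieldType) m (A : 'M[F]_m) :
  exists V, A ^+ mxindex A = A ^+ (mxindex A).+1 *m V.
Proof.
apply: (@mul_mxrank_eq_exr _ _ _ _ _ _ A); first by rewrite exprSr mulmxE.
by case: (mxindexP A).
Qed.

Section MinRankWeakDrazin.

Variables (C : numClosedFieldType) (m n : nat).
Variables (B X : 'M[C]_(m, n)) (W : 'M[C]_(n, m)).
Hypothesis hX : minrank_weighted_weak_Drazin B W X.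

Let A := B *m W.
Let k := mxindex A.

(** The defining equation makes [A ^+ k] a right multiple of [X]; the rank condition reverses
    this. *)
Lemma minrank_weak_Drazin_range : exists Z, X = A ^+ k *m Z.
Proof.
case: hX => XWA rkX.
apply: (@mul_mxrank_eq_exr _ _ _ _ _ _ (W *m A ^+ k.+1)).
  by rewrite mulmxA XWA.
by rewrite rkX.
Qed.

(** By the defining equation [X W A] fixes [A ^+ k], hence also its right multiple [X]. *)
Lemma minrank_weak_Drazin_outer : X *m W *m A *m X = X.
Proof.
have [Z XZ] := minrank_weak_Drazin_range; case: hX => XWA _.
by rewrite {2}XZ mulmxA -(mulmxA _ A) mulmxE -exprS -mulmxE XWA -XZ.
Qed.

Lemma minrank_weak_Drazin_mul_exprS :
  A *m X *m W *m A ^+ k.+1 = A ^+ k.+1.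
Proof.
case: hX => XWA _.
by rewrite -(mulmxA A X W) -(mulmxA A _ _) XWA mulmxE -exprS.
Qed.

Lemma minrank_weak_Drazin_idem_fix : A *m X *m W *m X = X.
Proof.
have [Z XZ] := minrank_weak_Drazin_range.
(* [P] is known to fix only [A ^+ k.+1]; the choice of [k] as the index lets it fix [A ^+ k] too. *)
have [V AV] := mxindex_exprS_exr A.
by rewrite {2}XZ AV !mulmxA minrank_weak_Drazin_mul_exprS -AV -XZ.
Qed.

(** This is [X W A X = X] multiplied by [A] on the left and [W] on the right. *)
Lemma minrank_weak_Drazin_mul_idem :
  A *m X *m W *m (A *m X *m W) = A *m X *m W.
Proof.
by rewrite -[RHS]/(A *m X *m W) -{3}minrank_weak_Drazin_outer !mulmxA.
Qed.

End MinRankWeakDrazin.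

Theorem theorem3p3 (R : realType) (m n : nat)
    (B : 'M[R[i]]_(m, n)) (W : 'M[R[i]]_(n, m)) (X : 'M[R[i]]_(m, n)) :
  minrank_weighted_weak_Drazin B W X ->
  forall Y : 'M[R[i]]_(n, m),
  let k := mxindex (B *m W) in
  let P := B *m W *m X *m W in
  let Bd := mpinv B in
  [<-> (* i *)   Y = weighted_weak_MPD B W X;
       (* ii *)  [/\ Y *m B *m Y = Y, B *m Y *m B = P *m B, B *m Y = P &
                     Y *m (B *m W) ^+ k.+1 = Bd *m (B *m W) ^+ k.+1];
       (* iii *) [/\ Y *m B *m Y = Y, B *m Y = P &
                     Y *m B = Bd *m B *m Y *m B];
       (* iv *)  [/\ B *m Y = P, Y *m B = Bd *m B *m Y *m B &
                     Y = Bd *m B *m Y];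
       (* v *)   [/\ Y *m B *m Y = Y, B *m Y = P,
                     Y *m (B *m W) ^+ k.+1 = Bd *m (B *m W) ^+ k.+1 &
                     Y *m X = Bd *m X];
       (* vi *)  [/\ Y = Bd *m B *m Y, B *m Y = P &
                     Y *m X *m Bd = Bd *m X *m Bd];
       (* vii *) [/\ Y = Bd *m B *m Y, B *m Y = P &
                     Y *m X *m W *m B = Bd *m X *m W *m B]].
Proof.
move=> hX Y k P Bd; have /and4P[/eqP BBdB _ _ _] := mpinvP B.
have iE : weighted_weak_MPD B W X = Bd *m P.
  by rewrite /weighted_weak_MPD /P !mulmxA.
(* [P] has left factor [B], so [B Bd] fixes it. *)
have BBdP : B *m (Bd *m P) = P by rewrite /P !mulmxA BBdB.
have PX : P *m X = X := minrank_weak_Drazin_idem_fix hX.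
have PP : P *m P = P := minrank_weak_Drazin_mul_idem hX.
have PA : P *m (B *m W) ^+ k.+1 = (B *m W) ^+ k.+1 :=
  minrank_weak_Drazin_mul_exprS hX.
have [Z XZ] := minrank_weak_Drazin_range hX.
have PZ : P = (B *m W) ^+ k.+1 *m (Z *m W).
  by rewrite /P {1}XZ exprS -mulmxE !mulmxA.
(* The range of P lies in that of (B W)^(k+1), so agreement there forces
   Y = Y P = Bd P. *)
have YE : Y *m B *m Y = Y -> B *m Y = P ->
    Y *m (B *m W) ^+ k.+1 = Bd *m (B *m W) ^+ k.+1 -> Y = Bd *m P.
  by move=> YBY BY YA; rewrite -YBY -mulmxA BY PZ mulmxA YA -mulmxA.
have BdPE : B *m Y = P -> Y = Bd *m B *m Y -> Y = Bd *m P.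
  by move=> BY ->; rewrite -mulmxA BY.
rewrite iE; tfae.
- move=> ->; rewrite BBdP; split=> //; last by rewrite -mulmxA PA.
  by rewrite -mulmxA BBdP -mulmxA PP.
- move=> [YBY _ BY YA]; split=> //.
  by rewrite -(mulmxA Bd) BY -YE.
- move=> [YBY BY YB]; split=> //.
  (* Here [Y = (Y B) Y = Bd (B Y) (B Y) = Bd P P = Bd P]. *)
  by rewrite -(mulmxA Bd) BY -YBY YB -(mulmxA Bd) BY -(mulmxA _ B) BY -mulmxA PP.
- move=> [BY _ YBd]; have YP := BdPE BY YBd.
  split=> //; first by rewrite -mulmxA BY YP -mulmxA PP.
    by rewrite YP -mulmxA PA.
  by rewrite YP -mulmxA PX.
- move=> [YBY BY YA YX]; split=> //; last by rewrite YX.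
  by rewrite -mulmxA BY -YE.
- move=> [YBd BY _]; split=> //.
  (* With [Y = Bd P], the identity [P X = X] gives [Y X = Bd X]. *)
  by rewrite (BdPE BY YBd) -(mulmxA Bd P) PX.
- by move=> [YBd BY _]; apply: BdPE.
Qed.
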